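(* Let $t\in[0,1)$ be a dyadic rational. Then there is a constant $c>0$, depending only on $t$, such that for every $f\in L_1(G)$ and every integer $n\ge 1$, $$E\left|\widetilde\sigma_n^{(t)}f\right|\le c\,E|f| .$$
   Context: **Dyadic group.** $G=\prod_{k=0}^{\infty}\{0,1\}$ is the Walsh (dyadic) group of sequences $x=(x_0,x_1,\dots)$, $x_k\in\{0,1\}$, with coordinatewise addition mod 2 and the product measure $\mu$ in which each coordinate takes the values $0,1$ with measure $1/2$ each. $E g=\int_G g\,d\mu$, and $L_1=L_1(G,\mu)$. **Walsh functions and coefficients.** $r_k(x)=(-1)^{x_k}$. For $k\in\mathbb N=\{0,1,2,\dots\}$ with binary expansion $k=\sum_{i\ge 0}k_i2^i$, $k_i\in\{0,1\}$, put $w_k(x)=\prod_{i\ge 0}r_i(x)^{k_i}$. For $f\in L_1$, $\widehat f(k)=E(fw_k)$. **Dyadic rationals and digits of $t$.** A dyadic rational in $[0,1)$ is a number of the form $p/2^k$ with $p,k\in\mathbb N$, $0\le p<2^k$. For $t\in[0,1)$ write $t=\sum_{j=0}^\infty t_j2^{-(j+1)}$, $t_j\in\{0,1\}$; if $t$ is a dyadic rational, the expansion terminating in zeros is chosen. **Conjugate partial sums and conjugate Fejér means.** Put $\beta_0(t)=(-1)^{t_0}$ and $\beta_k(t)=(-1)^{t_j}$ if $2^{j-1}\le k<2^j$ ($j\ge 1$). For $f\in L_1$, $$\widetilde S_n^{(t)}f=\sum_{k=0}^{n-1}\beta_k(t)\widehat f(k)w_k\quad(\widetilde S_0^{(t)}f=0),\qquad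 \widetilde\sigma_n^{(t)}f=\frac1n\sum_{k=0}^{n-1}\widetilde S_k^{(t)}f\quad(n\ge 1).$$ *)

(* Defs.v *)
From HB Require Import structures.
From mathcomp Require Import all_boot all_order all_algebra.
From mathcomp Require Import all_classical all_reals all_analysis.

Set Implicit Arguments.
Unset Strict Implicit.
Unset Printing Implicit Defensive.

Import Order.TTheory GRing.Theory Num.Theory.
Import numFieldNormedType.Exports.

Local Open Scope classical_set_scope.
Local Open Scope ring_scope.

(* For 0 <= t < 1 this is the digit t_j of t = \sum_j t_j 2^-(j+1), and for a
   dyadic rational it is the expansion terminating in zeros; see
   [digit_series] and [digit_dyadic]. *)
Definition digit {R : realType} (t : R) (j : nat) : bool :=
  odd (Num.truncn (2 ^+ j.+1 * t)).

Definition dyadic_rational {R : realType} (t : R) : Prop :=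
  exists p k : nat, (p < 2 ^ k)%N /\ t = p%:R / 2 ^+ k.

Section digit_theory.
Context {R : realType}.
Implicit Types (t : R) (j k n p : nat).

Lemma truncn_digitS t n : 0 <= t ->
  Num.truncn (2 ^+ n.+1 * t) = (digit t n + (Num.truncn (2 ^+ n * t)).*2)%N.
Proof.
move=> t0; rewrite -[LHS]odd_double_half; congr (_ + _.*2)%N.
set m := Num.truncn (2 ^+ n.+1 * t).
have /truncn_itv : 0 <= 2 ^+ n.+1 * t by rewrite mulr_ge0// exprn_ge0.
rewrite -/m => /andP[m1 m2]; apply/esym/truncn_def; apply/andP; split.
  rewrite -(@ler_pM2l _ 2)// mulrA -exprS -natrM (le_trans _ m1)// ler_nat.
  by rewrite mul2n -[leqRHS]odd_double_half leq_addl.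
rewrite -(@ltr_pM2l _ 2)// mulrA -exprS -natrM (lt_le_trans m2)// ler_nat.
by rewrite mul2n doubleS -[m in leqLHS]odd_double_half; case: (odd m).
Qed.

Lemma truncn_digit t n : 0 <= t -> t < 1 ->
  (Num.truncn (2 ^+ n * t))%:R / 2 ^+ n =
  \sum_(0 <= j < n) (digit t j)%:R / 2 ^+ j.+1 :> R.
Proof.
move=> t0 t1; elim: n => [|n IH].
  rewrite big_geq// expr0 mul1r divr1.
  by rewrite (_ : Num.truncn t = 0%N)//; apply: truncn_def; rewrite t0.
rewrite big_nat_recr//= -IH truncn_digitS// natrD -mul2n natrM mulrDl addrC.
by rewrite exprS -mulf_div divff// mul1r.
Qed.

Lemma digit_series t : 0 <= t -> t < 1 ->
  [series (digit t j)%:R / 2 ^+ j.+1 : R]_j @ \oo --> t.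
Proof.
move=> t0 t1.
have -> : [series (digit t j)%:R / 2 ^+ j.+1 : R]_j =
    (fun n => (Num.truncn (2 ^+ n * t))%:R / 2 ^+ n).
  by apply/funext => n; rewrite truncn_digit.
apply: (@squeeze_cvgr _ _ _ _ (fun n => t - 2^-1 ^+ n) (cst t)).
- near=> n.
  have /truncn_itv/andP[m1 m2] : 0 <= 2 ^+ n * t by rewrite mulr_ge0// exprn_ge0.
  rewrite ler_pdivrMr ?exprn_gt0// [t * _]mulrC m1 andbT.
  rewrite ler_pdivlMr ?exprn_gt0// mulrBl exprVn mulVf ?expf_neq0//.
  by rewrite lerBlDr mulrC natr1 ltW.
- rewrite -[X in _ --> X]subr0; apply: cvgB; first exact: cvg_cst.
  by apply: cvg_expr; rewrite ger0_norm ?invf_lt1 ?ltr1n.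
- exact: cvg_cst.
Unshelve. all: by end_near. Qed.

Lemma digit_dyadic p k j : (k <= j)%N -> digit (p%:R / 2 ^+ k : R) j = false.
Proof.
move=> kj; rewrite /digit mulrCA -expfB_cond; last first.
  by rewrite pnatr_eq0/= (leq_trans kj).
by rewrite -natrX -natrM natrK subSn// expnS oddM oddM/= andbF.
Qed.

Lemma digit_prefix t n (a : nat -> bool) : 0 <= t -> t < 1 ->
  (forall i, (i < n)%N -> digit t i = a i) <->
  Num.truncn (2 ^+ n * t) = (\sum_(i < n) a i * 2 ^ (n - i.+1))%N.
Proof.
move=> t0 t1; elim: n => [|n IH].
  rewrite big_ord0 expr0 mul1r; split => // _.
  by apply: truncn_def; rewrite t0.
have sumS : (\sum_(i < n.+1) a i * 2 ^ (n.+1 - i.+1))%N =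
    (a n + (\sum_(i < n) a i * 2 ^ (n - i.+1)).*2)%N.
  rewrite big_ord_recr/= subnn muln1 addnC; congr addn.
  rewrite -mul2n big_distrr/=; apply: eq_bigr => i _.
  by rewrite subSn// expnS mulnCA.
rewrite truncn_digitS// sumS; split => [ta|/[dup] tE /(congr1 odd)].
  by rewrite ta// (IH.1 _)// => i /ltnW ?; exact: ta.
rewrite !oddD !odd_double !addbF !oddb => tn i; rewrite ltnS leq_eqVlt.
move=> /predU1P[->//|]; move: i; apply/IH.
by move: tE; rewrite tn => /addnI /double_inj.
Qed.

Lemma measurable_digit j : measurable_fun setT (fun t : R => digit t j).
Proof.
apply: (measurable_fun_bool true); rewrite setTI.
have -> : (fun t : R => digit t j) @^-1` [set true] =
    \bigcup_(m in [set m | odd m])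
      `[m%:R / 2 ^+ j.+1, m.+1%:R / 2 ^+ j.+1[%classic.
  apply/seteqP; split => [t /= dt|t [m /= om]].
    have t0 : 0 <= 2 ^+ j.+1 * t.
      move: dt; rewrite /digit truncn_floor; case: ifPn => //.
    exists (Num.truncn (2 ^+ j.+1 * t)) => //=; rewrite in_itv/=.
    rewrite ler_pdivrMr ?exprn_gt0// ltr_pdivlMr ?exprn_gt0//.
    by rewrite [t * _]mulrC truncn_itv.
  rewrite in_itv/= ler_pdivrMr ?exprn_gt0// ltr_pdivlMr ?exprn_gt0//.
  by rewrite [t * _]mulrC => /truncn_def; rewrite /digit => ->.
by apply: bigcup_measurable => m _; exact: measurable_itv.
Qed.

End digit_theory.

Definition coordinate_sets : set (set (nat -> bool)) :=
  [set A | exists (i : nat) (B : set bool), A = [set x | B (x i)]].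

(* {0,1}^nat with its product sigma-algebra; the coordinate x_k is [x k]. *)
Definition walsh_group : Type := g_sigma_algebraType coordinate_sets.

HB.instance Definition _ := Measurable.on walsh_group.

Definition cylinder (n : nat) (a : nat -> bool) : set walsh_group :=
  [set x | forall i, (i < n)%N -> x i = a i].

Definition digits {R : realType} (t : R) : walsh_group := digit t.

Lemma measurable_digits {R : realType} :
  measurable_fun setT (digits : R -> walsh_group).
Proof.
apply: (@measurability _ _ _ walsh_group setT _ coordinate_sets) => // _ [_ [i [B ->]] <-].
by apply: measurable_digit => //; exact: discrete_measurable.
Qed.

HB.instance Definition _ {R : realType} := isMeasurableFun.Build _ _ _ _
  (digits : measurableTypeR R -> walsh_group) (@measurable_digits R).

(* The library has no infinite product of measures: the product of the uniform
   measures on {0,1} is obtained as the law of the sequence of binary digits of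
   a uniform point of [0,1].  [walsh_measure_cylinder] and
   [walsh_measure_unique] characterize it as the product measure. *)
Definition walsh_measure (R : realType) : set walsh_group -> \bar R :=
  distribution (uniform_prob (@ltr01 R)) (@digits R).

HB.instance Definition _ (R : realType) :=
  Probability.on (walsh_measure R).

Section walsh_measure_theory.
Context {R : realType}.

Lemma measurable_cylinder n a : measurable (cylinder n a).
Proof.
have -> : cylinder n a = \bigcap_(i in `I_n) [set x | x i = a i] by [].
apply: bigcap_measurableType => i _; apply: sub_sigma_algebra.
by exists i, [set a i].
Qed.

Lemma uniform_prob01E (A : set R) : measurable A ->
  uniform_prob (@ltr01 R) A = lebesgue_measure (A `&` `[0, 1[%classic).
Proof.
move=> mA; rewrite /uniform_prob integral_uniform_pdf.
rewrite (eq_integral (fun=> 1%:E)); last first.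
  by move=> x; rewrite inE => -[_ /=]; rewrite in_itv/= /uniform_pdf => ->;
     rewrite subr0 invr1.
rewrite integral_cst ?mul1e; last exact: measurableI.
rewrite -(@setUitv1 _ _ (BLeft 0) 1 true) ?bnd_simp// setIUr measureU0//.
- exact: measurableI.
- exact: measurableI.
- apply/eqP; rewrite eq_le measure_ge0 andbT -(@lebesgue_measure_set1 R 1).
  by rewrite le_measure// inE//; exact: measurableI.
Qed.

Lemma walsh_measure_cylinder n a :
  walsh_measure R (cylinder n a) = (2^-1 ^+ n)%:E.
Proof.
have mC : measurable (digits @^-1` cylinder n a : set R).
  rewrite -[X in measurable X]setTI.
  by apply: measurable_digits => //; exact: measurable_cylinder.
rewrite /walsh_measure /distribution /pushforward [LHS]uniform_prob01E//.
pose K := (\sum_(i < n) a i * 2 ^ (n - i.+1))%N.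
have K2n : (K.+1 <= 2 ^ n)%N.
  rewrite /K; elim: n a {mC K} => [|n IH] a; first by rewrite big_ord0.
  rewrite big_ord_recl/= subn1/= expnS mul2n -addnn -addnS leq_add//.
    by case: (a 0%N); rewrite ?mul1n ?mul0n.
  exact: (IH (fun i => a i.+1)).
have -> : digits @^-1` cylinder n a `&` `[0, 1[ =
    `[K%:R / 2 ^+ n, K.+1%:R / 2 ^+ n[%classic :> set R.
  apply/seteqP; split => u /=; rewrite !in_itv/=.
    move=> [ua /andP[u0 u1]].
    have /truncn_itv : 0 <= 2 ^+ n * u by rewrite mulr_ge0 ?exprn_ge0.
    rewrite ((digit_prefix n a u0 u1).1 ua) -/K => uK.
    by rewrite ler_pdivrMr ?exprn_gt0// ltr_pdivlMr ?exprn_gt0// [u * _]mulrC.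
  move=> /andP[Ku uK].
  have u0 : 0 <= u by rewrite (le_trans _ Ku)// divr_ge0// exprn_ge0.
  have u1 : u < 1.
    rewrite (lt_le_trans uK)// ler_pdivrMr ?exprn_gt0// mul1r.
    by rewrite -natrX ler_nat.
  rewrite u0 u1; split => //; apply/(digit_prefix n a u0 u1)/truncn_def.
  by rewrite [_ * u]mulrC -ler_pdivrMr ?exprn_gt0// -ltr_pdivlMr ?exprn_gt0// Ku.
rewrite lebesgue_measure_itv/= lte_fin ltr_pM2r ?invr_gt0 ?exprn_gt0//.
rewrite ltr_nat ltnSn -EFinB -mulrBl -natrB// subSnn mul1r.
by rewrite exprVn.
Qed.

Let cylinders : set (set walsh_group) :=
  [set A | A = set0 \/ exists n a, A = cylinder n a].

Let cylindersI : setI_closed cylinders.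
Proof.
have cylI n a m b : (n <= m)%N -> cylinders (cylinder n a `&` cylinder m b).
  move=> nm; have [ab|ab] := pselect (forall i, (i < n)%N -> a i = b i).
    right; exists m, b; apply/setIidr => x xb i ni /=.
    by rewrite ab// xb// (leq_trans ni).
  left; rewrite -subset0 => x [xa xb]; apply: ab => i ni.
  by rewrite -xa// xb// (leq_trans ni).
move=> A B [->|[n [a ->]]] [->|[m [b ->]]]; rewrite ?setI0 ?set0I; try by left.
have [/cylI//|/ltnW] := leqP n m.
by rewrite setIC => /cylI.
Qed.

Let measurable_cylinders : @measurable _ walsh_group = <<s cylinders >>.
Proof.
apply/seteqP; split; last first.
  apply: smallest_sub; first exact: sigma_algebra_measurable.
  by move=> _ [->//|[n [a ->]]]; exact: measurable_cylinder.
apply: smallest_sub; first exact: smallest_sigma_algebra.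
move=> _ [i [B ->]]; pose ext (s : {ffun 'I_i.+1 -> bool}) k := s (inord k).
have -> : [set x : walsh_group | B (x i)] =
    \bigcup_(s in [set s | B (ext s i)]) cylinder i.+1 (ext s).
  apply/seteqP; split => [x Bx|x [s /= Bs xs]]; last by rewrite xs.
  have xE k : (k < i.+1)%N -> x k = ext [ffun j : 'I_i.+1 => x j] k.
    by move=> ki; rewrite /ext ffunE inordK.
  by exists [ffun j : 'I_i.+1 => x j]; rewrite //= -xE.
apply: (@fin_bigcup_measurable _ (g_sigma_algebraType cylinders)).
  exact: finite_finset.
by move=> s _; apply: sub_sigma_algebra; right; exists i.+1, (ext s).
Qed.

Lemma walsh_measure_unique (m : {measure set walsh_group -> \bar R}) :
  (forall n a, m (cylinder n a) = (2^-1 ^+ n)%:E) ->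
  forall A, measurable A -> m A = walsh_measure R A.
Proof.
move=> mE A mA; apply: (measure_unique cylinders (fun=> setT)) => //.
- move=> _; right; exists 0%N, (fun=> false); apply/seteqP; by split.
- exact: bigcup_const.
- by move=> _ [->|[n [a ->]]]; rewrite ?measure0 ?mE//; exact/esym/walsh_measure_cylinder.
- move=> _; have -> : setT = cylinder 0 (fun=> false) by apply/seteqP; split.
  by rewrite mE ltry.
Qed.
End walsh_measure_theory.

Section conjugate_means.
Context {R : realType}.
Implicit Types (f : walsh_group -> R) (x : walsh_group) (t : R).

Definition rademacher (k : nat) x : R := (-1) ^+ x k.

(* The digit k_i of k is [odd (k %/ 2 ^ i)], which is 0 for k <= i. *)
Definition walsh (k : nat) x : R :=
  \prod_(i < k) rademacher i x ^+ odd (k %/ 2 ^ i).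

Definition walsh_coef f (k : nat) : R :=
  fine 'E_(walsh_measure R)[(fun x => f x * walsh k x)%R].

(* For k > 0, j = (trunc_log 2 k).+1 is the j such that 2^(j-1) <= k < 2^j. *)
Definition conj_mult t (k : nat) : R :=
  if k == 0%N then (-1) ^+ digit t 0 else (-1) ^+ digit t (trunc_log 2 k).+1.

Definition conj_sum t (n : nat) f x : R :=
  \sum_(k < n) conj_mult t k * walsh_coef f k * walsh k x.

Definition conj_fejer t (n : nat) f x : R :=
  n%:R^-1 * \sum_(k < n) conj_sum t k f x.

End conjugate_means.

(* Main.v *)
(* If t is a dyadic rational, beta_k(t) = 1 for all k >= 2^e, so the conjugate
   Fejer kernel differs from the Fejer kernel by at most 2^e Walsh functions with
   coefficients bounded by 2. The L1 bound 2 for the Fejer kernel (Yano) comes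
   from T_n = \sum_(k < n) D_k, where D_k is the Dirichlet kernel, through
     T_(2^A + m) = T_(2^A) + m D_(2^A) + r_A T_m   (m <= 2^A):
   the L1 norm of D_(2^A) is 1, and for m = 2^A the factor 1 + r_A is nonnegative,
   has mean 1 and is independent of T_(2^A), so that T_(2^A) has L1 norm <= 2^A. *)
From HB Require Import structures.
Require Import Defs.
From mathcomp Require Import all_boot all_order all_algebra.
From mathcomp Require Import all_classical all_reals all_analysis.
From mathcomp Require Import measurable_realfun ring lra.

Import Order.TTheory GRing.Theory Num.Theory.

Local Open Scope classical_set_scope.
Local Open Scope ring_scope.

(** * Bounded measurable functions on the Walsh group and their integrals *)

Section tame_functions.
Context {R : realType}.
Notation P := (walsh_measure R).
Implicit Types (f g : walsh_group -> R) (x y : walsh_group).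

(** Such functions are closed under sums and products and are integrable for the probability [P],
    which settles the integrability side conditions for the kernels. *)
Definition tame g := measurable_fun setT g /\ exists M, forall x, `|g x| <= M.

Lemma tame_bounded {g} : tame g -> [bounded g x | x in setT].
Proof.
move=> [_ [M gM]]; exists M; split; first exact: num_real.
by move=> N MN x _; exact: le_trans (gM x) (ltW MN).
Qed.

Lemma tame_integrable {g} : tame g -> P.-integrable setT (EFin \o g).
Proof.
move=> tg; apply: measurable_bounded_integrable => //.
- exact: le_lt_trans (probability_le1 P measurableT) (ltry _).
- exact: tg.1.
- exact: tame_bounded.
Qed.

Lemma integrableM_tame {f g} : P.-integrable setT (EFin \o f) -> tame g ->
  P.-integrable setT (EFin \o (fun x => f x * g x)).
Proof.
move=> fi tg.
exact: (integrableMl measurableT fi tg.1 (tame_bounded tg)).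
Qed.

Lemma integrableZlR (a : R) {f} : P.-integrable setT (EFin \o f) ->
  P.-integrable setT (EFin \o (fun x => a * f x)).
Proof. by move=> fi; exact: (integrableZl measurableT a fi). Qed.

Lemma tame_cst (a : R) : tame (fun=> a).
Proof. by split; [exact: measurable_cst | exists `|a|]. Qed.

Lemma tameD {f g} : tame f -> tame g -> tame (fun x => f x + g x).
Proof.
move=> [mf [M fM]] [mg [N gN]]; split; first exact: measurable_funD.
by exists (M + N) => x; rewrite (le_trans (ler_normD _ _))// lerD.
Qed.

Lemma tameM {f g} : tame f -> tame g -> tame (fun x => f x * g x).
Proof.
move=> [mf [M fM]] [mg [N gN]]; split; first exact: measurable_funM.
by exists (M * N) => x; rewrite normrM ler_pM.
Qed.

Lemma tame_norm {g} : tame g -> tame (fun x => `|g x|).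
Proof.
move=> [mg [M gM]]; split; first exact: measurableT_comp.
by exists M => x; rewrite normr_id.
Qed.

Lemma tame_sum {I : Type} {s : seq I} {F : I -> walsh_group -> R} :
  (forall i, tame (F i)) -> tame (fun x => \sum_(i <- s) F i x).
Proof.
move=> tF; elim: s => [|i s IH].
  by under eq_fun do rewrite big_nil; exact: tame_cst.
by under eq_fun do rewrite big_cons; exact: tameD.
Qed.

Lemma integrable_sumR {I : Type} {s : seq I} {F : I -> walsh_group -> R} :
  (forall i, P.-integrable setT (EFin \o F i)) ->
  P.-integrable setT (EFin \o (fun x => \sum_(i <- s) F i x)).
Proof.
move=> iF.
rewrite (_ : EFin \o _ = fun x => (\sum_(i <- s) (F i x)%:E)%E).
  by apply: integrable_sum => // i _; exact: iF.
by apply/funext => x /=; rewrite sumEFin.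
Qed.

Lemma Rintegral_sum {I : Type} {s : seq I} {F : I -> walsh_group -> R} :
  (forall i, P.-integrable setT (EFin \o F i)) ->
  \int[P]_x (\sum_(i <- s) F i x) = \sum_(i <- s) \int[P]_x F i x.
Proof.
move=> iF; elim: s => [|i s IH].
  under eq_Rintegral do rewrite big_nil.
  by rewrite big_nil Rintegral_cst// mul0r.
rewrite big_cons -IH -RintegralD//; last exact: integrable_sumR.
by apply: eq_Rintegral => x _; rewrite big_cons.
Qed.

End tame_functions.

(** * Translation invariance of the measure *)

Section translation.
Context {R : realType}.
Notation P := (walsh_measure R).
Implicit Types (f g : walsh_group -> R) (x y : walsh_group).

Definition translate (h x : walsh_group) : walsh_group := fun k => x k (+) h k.

Lemma measurable_translate h : measurable_fun setT (translate h).
Proof.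
apply: (@measurability _ _ _ walsh_group setT _ coordinate_sets) => //.
move=> _ [_ [i [B ->]] <-]; rewrite setTI; apply: sub_sigma_algebra.
by exists i, [set b | B (b (+) h i)].
Qed.

HB.instance Definition _ h := isMeasurableFun.Build _ _ _ _
  (translate h) (measurable_translate h).

(** The preimage of a cylinder is a cylinder of the same length, and the values on cylinders
    determine the measure. *)
Lemma walsh_measure_translate h A : measurable A ->
  pushforward P (translate h) A = P A.
Proof.
move=> mA; apply: (walsh_measure_unique (m := pushforward P (translate h))) => // n a.
rewrite -(walsh_measure_cylinder n (fun k => a k (+) h k)) /pushforward.
congr (P _); apply/seteqP; split => x /= xa i ni.
  by rewrite -xa// /translate addbK.
by rewrite /translate xa// addbK.
Qed.

Lemma tame_translate h {g} : tame g -> tame (fun x => g (translate h x)).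
Proof.
move=> [mg [M gM]]; split; last by exists M => x.
exact: (measurableT_comp mg (measurable_translate h)).
Qed.

Lemma Rintegral_translate h {g} : tame g ->
  \int[P]_x g (translate h x) = \int[P]_x g x.
Proof.
move=> tg; congr fine.
rewrite -[RHS](@eq_measure_integral _ _ _ setT _ (pushforward P (translate h)));
  last by move=> A mA _; exact: walsh_measure_translate.
rewrite [RHS]integral_pushforward//; last exact: (tame_integrable (tame_translate h tg)).
by apply/measurable_EFinP; exact: tg.1.
Qed.

End translation.

(** * Walsh functions as characters of the group *)

Section walsh_functions.
Context {R : realType}.
Implicit Types (x y : walsh_group).
Notation walsh := (@walsh R).

(** The binary digits of [k] vanish from position [N] on, so products for different indices can be
    taken over a common range. *)
Lemma walsh_prod {k N x} : (k < 2 ^ N)%N ->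
  walsh k x = \prod_(i < N) rademacher i x ^+ odd (k %/ 2 ^ i).
Proof.
move=> kN; rewrite /Defs.walsh.
rewrite -(big_mkord xpredT (fun i => rademacher i x ^+ odd (k %/ 2 ^ i))).
rewrite -(big_mkord xpredT (fun i => rademacher i x ^+ odd (k %/ 2 ^ i))).
have low m n : (m <= n)%N -> (k < 2 ^ m)%N ->
    \prod_(0 <= i < n) rademacher i x ^+ odd (k %/ 2 ^ i) =
    \prod_(0 <= i < m) rademacher i x ^+ odd (k %/ 2 ^ i) :> R.
  move=> mn km; rewrite (big_cat_nat (n := m))//= [X in _ * X]big_nat.
  rewrite [X in _ * X]big1 ?mulr1// => i /andP[mi _].
  by rewrite divn_small// (leq_trans km)// leq_exp2l.
(* The definition multiplies over [i < k]; the longer of the two ranges is cut to the shorter one,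
   using [k < 2 ^ k] when [k] is the smaller bound. *)
have [Nk|/ltnW kN'] := leqP N k; first by rewrite (low _ _ Nk).
by rewrite (low _ _ kN')// ltn_expl.
Qed.

Lemma walsh_translate k h x : walsh k (translate h x) = walsh k x * walsh k h.
Proof.
rewrite /Defs.walsh -big_split/=; apply: eq_bigr => i _.
by rewrite /rademacher signr_addb exprMn.
Qed.

Lemma walsh_norm k x : `|walsh k x| = 1.
Proof.
rewrite /Defs.walsh normr_prod big1// => i _.
by rewrite /rademacher !normrX normrN1 !expr1n.
Qed.

Lemma walsh0 x : walsh 0 x = 1.
Proof. by rewrite /Defs.walsh big_ord0. Qed.

(** Adding [2 ^ A] sets digit [A] and leaves the lower digits, those of [j], unchanged. *)
Lemma walsh_pow2D A j x : (j < 2 ^ A)%N ->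
  walsh (2 ^ A + j) x = rademacher A x * walsh j x.
Proof.
move=> jA; rewrite (@walsh_prod _ A.+1); last first.
  by rewrite expnS mul2n -addnn ltn_add2l.
rewrite big_ord_recr/= (walsh_prod jA) mulrC; congr (_ * _).
  by rewrite divnDl// divnn expn_gt0/= divn_small.
apply: eq_bigr => i _; have iA := ltn_ord i.
(* For [i < A] the quotient [2 ^ (A - i)] is even, so digit [i] is that of [j]. *)
rewrite divnDl ?dvdn_exp2l 1?ltnW// -expnB 1?ltnW// oddD oddX.
by rewrite subn_eq0 leqNgt iA.
Qed.

Lemma measurable_rademacher k : measurable_fun setT (@rademacher R k).
Proof.
apply: (measurableT_comp (f := fun b : bool => (-1) ^+ b : R)) => //.
move=> _ B mB; rewrite setTI; apply: sub_sigma_algebra.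
by exists k, B.
Qed.

Lemma tame_rademacher k : tame (@rademacher R k).
Proof.
split; first exact: measurable_rademacher.
by exists 1 => x; rewrite /rademacher normrX normrN1 expr1n.
Qed.

Lemma tame_walsh k : tame (walsh k).
Proof.
split; last by exists 1 => x; rewrite walsh_norm.
apply: measurable_prod => i _; apply: measurable_funX.
exact: measurable_rademacher.
Qed.

Lemma tame_walsh_sum (m : nat -> R) n : tame (fun x => \sum_(k < n) m k * walsh k x).
Proof.
by apply: tame_sum => k; apply: tameM; [exact: tame_cst|exact: tame_walsh].
Qed.

End walsh_functions.

(** * Walsh multipliers on L1 *)

Section multipliers.
Context {R : realType}.
Notation P := (walsh_measure R).
Notation walsh := (@walsh R).

(* By duality: testing against the sign s of the left-hand integrand moves the
   multiplier onto s, where it acts as convolution with the kernel. *)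
Lemma walsh_multiplier_L1 (m : nat -> R) n (f : walsh_group -> R) :
  P.-integrable setT (EFin \o f) ->
  \int[P]_x `|\sum_(k < n) m k * walsh_coef f k * walsh k x| <=
  (\int[P]_x `|\sum_(k < n) m k * walsh k x|) * \int[P]_x `|f x|.
Proof.
move=> fi; set c := \int[P]_x `|\sum_(k < n) m k * walsh k x|.
pose K x := \sum_(k < n) m k * walsh k x.
have tK : tame K by exact: tame_walsh_sum.
pose g x := \sum_(k < n) m k * walsh_coef f k * walsh k x.
have tg : tame g by exact: (tame_walsh_sum (fun k => m k * walsh_coef f k)).
(* Taking the value [1] at the zeros of [g] keeps [|s| = 1] everywhere. *)
pose s x : R := if 0 <= g x then 1 else -1.
have s1 x : `|s x| = 1 by rewrite /s; case: ifP; rewrite ?normrN normr1.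
have ts : tame s.
  split; last by exists 1 => x; rewrite s1.
  by apply: measurable_fun_ifT => //; apply: measurable_fun_ler => //; exact: tg.1.
pose a k := \int[P]_x (s x * walsh k x).
pose h x := \sum_(k < n) m k * a k * walsh k x.
have th : tame h by exact: (tame_walsh_sum (fun k => m k * a k)).
have coefE k : walsh_coef f k = \int[P]_x (f x * walsh k x).
  by rewrite /walsh_coef unlock.
have gsE x : `|g x| = \sum_(k < n) m k * walsh_coef f k * (s x * walsh k x).
  transitivity (s x * g x).
    rewrite /s; case: ifPn => [g0|]; first by rewrite mul1r ger0_norm.
    by rewrite -ltNge => g0; rewrite mulN1r ltr0_norm.
  by rewrite /g mulr_sumr; apply: eq_bigr => k _; rewrite mulrCA.
have fhE x : f x * h x = \sum_(k < n) m k * a k * (f x * walsh k x).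
  by rewrite /h mulr_sumr; apply: eq_bigr => k _; rewrite mulrCA.
(* The multiplier is self-adjoint: both integrals equal the sum of [m k * walsh_coef f k * a k]. *)
have -> : \int[P]_x `|g x| = \int[P]_x (f x * h x).
  under eq_Rintegral do rewrite gsE.
  under [RHS]eq_Rintegral do rewrite fhE.
  have tsw k : tame (fun x => s x * walsh k x) by apply: tameM => //; exact: tame_walsh.
  rewrite !Rintegral_sum//.
  - apply: eq_bigr => k _.
    rewrite !RintegralZl//; last 2 first.
    + exact: integrableM_tame (tame_walsh k).
    + exact: tame_integrable.
    by rewrite coefE mulrAC.
  - by move=> k; apply: integrableZlR; exact: integrableM_tame (tame_walsh k).
  - by move=> k; apply: tame_integrable; apply: tameM => //; exact: tame_cst.
(* [h] is the convolution of [s] with [K]; since [|s| = 1], translation invariance bounds it by the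
   L1 norm of [K]. *)
have hc x : `|h x| <= c.
  have -> : h x = \int[P]_y (s y * K (translate x y)).
    transitivity (\int[P]_y (\sum_(k < n) (m k * walsh k x) * (s y * walsh k y))).
      rewrite Rintegral_sum; last first.
        move=> k; apply: tame_integrable; apply: tameM; first exact: tame_cst.
        by apply: tameM => //; exact: tame_walsh.
      apply: eq_bigr => k _; rewrite RintegralZl// -/(a k) 1?mulrAC//.
      by apply: tame_integrable; apply: tameM => //; exact: tame_walsh.
    apply: eq_Rintegral => y _; rewrite mulr_sumr; apply: eq_bigr => k _.
    by rewrite walsh_translate; ring.
  have tKx := tame_translate x tK.
  rewrite (le_trans (le_normr_Rintegral _ _))//; first exact/tame_integrable/tameM.
  under eq_Rintegral do rewrite normrM s1 mul1r.
  by rewrite (Rintegral_translate x (tame_norm tK)).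
have fhi := integrableM_tame fi th.
rewrite (le_trans (ler_norm _))// (le_trans (le_normr_Rintegral _ _))//.
rewrite -RintegralZl//; last exact: integrable_norm.
apply: le_Rintegral => //.
- exact: integrable_norm.
- exact: (integrableZlR c (integrable_norm _)).
- by move=> x _; rewrite normrM mulrC ler_wpM2r.
Qed.

End multipliers.

(** * L1 norms of the Dirichlet and Fejer kernels *)

Section fejer_kernel.
Context {R : realType}.
Notation P := (walsh_measure R).
Notation walsh := (@walsh R).
Notation r := (@rademacher R).
Implicit Types (x : walsh_group).

Definition L1norm (g : walsh_group -> R) : R := \int[P]_x `|g x|.

Lemma eq_L1norm {f g : walsh_group -> R} : f =1 g -> L1norm f = L1norm g.
Proof. by move=> /funext ->. Qed.

Lemma L1norm_cst (a : R) : L1norm (fun=> a) = `|a|.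
Proof.
rewrite /L1norm Rintegral_cst//.
by rewrite [fine _](congr1 fine (probability_setT P)) mulr1.
Qed.

Lemma ler_L1normD {f g : walsh_group -> R} : tame f -> tame g ->
  L1norm (fun x => f x + g x) <= L1norm f + L1norm g.
Proof.
move=> tf tg; rewrite /L1norm -RintegralD//;
  try exact: (tame_integrable (tame_norm _)).
apply: le_Rintegral => // [||x _]; last exact: ler_normD.
- exact: (tame_integrable (tame_norm (tameD tf tg))).
- exact: (tame_integrable (tameD (tame_norm tf) (tame_norm tg))).
Qed.

Lemma L1normZ (a : R) {g : walsh_group -> R} : tame g ->
  L1norm (fun x => a * g x) = `|a| * L1norm g.
Proof.
move=> tg; rewrite /L1norm; under eq_Rintegral do rewrite normrM.
by rewrite RintegralZl//; exact: (tame_integrable (tame_norm tg)).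
Qed.

(** Translation by the unit vector at [A]; invariance under it says that a function does not depend
    on coordinate [A]. *)
Definition flip (A : nat) : walsh_group -> walsh_group :=
  translate (fun k => k == A).

Lemma rademacher_flip A x : r A (flip A x) = - r A x.
Proof. by rewrite /rademacher /flip /translate eqxx addbT signrN. Qed.

Lemma rademacher1D_ge0 A x : 0 <= 1 + r A x.
Proof. by rewrite /rademacher; case: (x A); rewrite ?expr1 ?expr0; lra. Qed.

(** [walsh k] involves only coordinates below [A], so its value at the unit vector at [A] is 1. *)
Lemma walsh_flip A k x : (k < 2 ^ A)%N -> walsh k (flip A x) = walsh k x.
Proof.
move=> kA; rewrite /flip walsh_translate [X in _ * X](walsh_prod kA).
rewrite big1 ?mulr1// => i _.
by rewrite /rademacher ltn_eqF// expr0 expr1n.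
Qed.

(* [r A] is independent of [g] and has mean 0. *)
Lemma Rintegral_1Drademacher A (g : walsh_group -> R) : tame g ->
  (forall x, g (flip A x) = g x) ->
  \int[P]_x ((1 + r A x) * g x) = \int[P]_x g x.
Proof.
move=> tg gA; have trg := tameM (tame_rademacher A) tg.
under eq_Rintegral do rewrite mulrDl mul1r.
rewrite RintegralD//; try exact: tame_integrable.
(* The flip preserves the integral and changes the sign of the integrand, so the integral is its own
   opposite. *)
suff : \int[P]_x (r A x * g x) = - \int[P]_x (r A x * g x).
  by move=> /esym/eqP; rewrite eqNr => /eqP ->; rewrite addr0.
rewrite -{1}(Rintegral_translate (fun k => k == A) trg) -mulN1r -RintegralZl//.
  apply: eq_Rintegral => x _.
  by rewrite -/(flip A x) rademacher_flip gA mulN1r mulNr.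
exact: tame_integrable.
Qed.

Definition dirichlet n x : R := \sum_(k < n) walsh k x.

(** This is [n] times the Fejer kernel; the sum starts with [dirichlet 0 = 0], as [conj_fejer]
    starts with [conj_sum t 0 f = 0]. *)
Definition fejer_sum n x : R := \sum_(k < n) dirichlet k x.

Lemma tame_dirichlet n : tame (dirichlet n).
Proof. by apply: tame_sum => k; exact: tame_walsh. Qed.

Lemma tame_fejer_sum n : tame (fejer_sum n).
Proof. by apply: tame_sum => k; exact: tame_dirichlet. Qed.

Lemma dirichlet_flip A n x : (n <= 2 ^ A)%N ->
  dirichlet n (flip A x) = dirichlet n x.
Proof.
move=> nA; apply: eq_bigr => k _.
by rewrite walsh_flip// (leq_trans (ltn_ord k)).
Qed.

Lemma fejer_sum_flip A n x : (n <= 2 ^ A)%N ->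
  fejer_sum n (flip A x) = fejer_sum n x.
Proof.
move=> nA; apply: eq_bigr => k _.
by rewrite dirichlet_flip// ltnW// (leq_trans (ltn_ord k)).
Qed.

Lemma dirichlet_pow2D A m x : (m <= 2 ^ A)%N ->
  dirichlet (2 ^ A + m) x = dirichlet (2 ^ A) x + r A x * dirichlet m x.
Proof.
move=> mA; rewrite /dirichlet big_split_ord/=; congr (_ + _).
rewrite mulr_sumr; apply: eq_bigr => k _.
by rewrite walsh_pow2D// (leq_trans (ltn_ord k)).
Qed.

Lemma fejer_sum_pow2D A m x : (m <= 2 ^ A)%N ->
  fejer_sum (2 ^ A + m) x =
  fejer_sum (2 ^ A) x + m%:R * dirichlet (2 ^ A) x + r A x * fejer_sum m x.
Proof.
move=> mA; rewrite {1}/fejer_sum big_split_ord/= -addrA; congr (_ + _).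
have -> : m%:R * dirichlet (2 ^ A) x = \sum_(k < m) dirichlet (2 ^ A) x.
  by rewrite sumr_const card_ord mulr_natl.
rewrite mulr_sumr -big_split/=.
apply: eq_bigr => k _.
by rewrite dirichlet_pow2D// ltnW// (leq_trans (ltn_ord k)).
Qed.

(** Passing from [A] to [A + 1] multiplies the kernel by [1 + r A], which is nonnegative, has mean 1
    and is independent of it. Nonnegativity turns the mean into the L1 norm. *)
Lemma dirichlet_pow2_mean A :
  (forall x, 0 <= dirichlet (2 ^ A) x) /\ \int[P]_x dirichlet (2 ^ A) x = 1.
Proof.
elim: A => [|A [IH0 IH1]].
  have D1 x : dirichlet (2 ^ 0) x = 1 by rewrite /dirichlet big_ord1 walsh0.
  split=> [x|]; first by rewrite D1.
  under eq_Rintegral do rewrite D1.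
  by rewrite -[RHS]normr1 -(L1norm_cst 1) /L1norm normr1.
have DS x : dirichlet (2 ^ A.+1) x = (1 + r A x) * dirichlet (2 ^ A) x.
  by rewrite expnS mul2n -addnn dirichlet_pow2D// mulrDl mul1r.
split=> [x|]; first by rewrite DS mulr_ge0// rademacher1D_ge0.
under eq_Rintegral do rewrite DS.
rewrite Rintegral_1Drademacher//; first exact: tame_dirichlet.
by move=> x; exact: dirichlet_flip.
Qed.

Lemma L1norm_dirichlet_pow2 A : L1norm (dirichlet (2 ^ A)) = 1.
Proof.
have [D0 <-] := dirichlet_pow2_mean A.
by apply: eq_Rintegral => x _; rewrite ger0_norm.
Qed.

Lemma L1norm_fejer_sum_pow2 A : L1norm (fejer_sum (2 ^ A)) <= 2 ^+ A.
Proof.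
elim: A => [|A IH].
  rewrite (@eq_L1norm _ (fun=> 0)) ?L1norm_cst ?normr0 ?expr0//.
  by move=> x; rewrite /fejer_sum big_ord1 /dirichlet big_ord0.
(* This is [fejer_sum_pow2D] with [m = 2 ^ A]. The second term has norm [2 ^ A], so it remains to
   bound the first by [2 ^ A] as well. *)
rewrite (@eq_L1norm _ (fun x =>
    (1 + r A x) * fejer_sum (2 ^ A) x + 2 ^+ A * dirichlet (2 ^ A) x)); last first.
  by move=> x; rewrite expnS mul2n -addnn fejer_sum_pow2D// natrX; ring.
have tr : tame (fun x => 1 + r A x) by exact: tameD (tame_cst 1) (tame_rademacher A).
have tF := tame_fejer_sum (2 ^ A); have tD := tame_dirichlet (2 ^ A).
rewrite (le_trans (ler_L1normD (tameM tr tF) (tameM (tame_cst _) tD)))//.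
rewrite L1normZ// L1norm_dirichlet_pow2 mulr1 ger0_norm ?exprn_ge0//.
rewrite exprS mulr_natl mulr2n lerD2r (le_trans _ IH)//.
(* The factor [1 + r A] is nonnegative, so it leaves the absolute value, and it then averages out
   against the flip-invariant [|fejer_sum (2 ^ A)|]. *)
rewrite [leRHS]/L1norm -(Rintegral_1Drademacher A _ (tame_norm tF)); last first.
  by move=> x; rewrite fejer_sum_flip.
rewrite le_eqVlt; apply/orP; left; apply/eqP/eq_Rintegral => x _.
by rewrite normrM ger0_norm// rademacher1D_ge0.
Qed.

(* Yano's bound: peeling off the leading binary digit [2 ^ A] of [n]. *)
Lemma L1norm_fejer_sum n : L1norm (fejer_sum n) <= 2 * n%:R.
Proof.
elim/ltn_ind: n => -[_|n IH].
  rewrite (@eq_L1norm _ (fun=> 0)) ?L1norm_cst ?normr0 ?mulr0//.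
  by move=> x; rewrite /fejer_sum big_ord0.
have [A [m mA nE]] : exists A, exists2 m, (m < 2 ^ A)%N & n.+1 = (2 ^ A + m)%N.
  exists (trunc_log 2 n.+1), (n.+1 - 2 ^ trunc_log 2 n.+1)%N.
    by rewrite ltn_subLR ?trunc_logP// addnn -mul2n -expnS trunc_log_ltn.
  by rewrite subnKC// trunc_logP.
have IHm : L1norm (fejer_sum m) <= 2 * m%:R.
  by apply: IH; rewrite nE -[ltnLHS]add0n ltn_add2r expn_gt0.
have tD : tame (fun x => m%:R * dirichlet (2 ^ A) x).
  by apply: tameM; [exact: tame_cst|exact: tame_dirichlet].
have tF := tame_fejer_sum.
have trF := tameM (tame_rademacher A) (tF m).
rewrite nE (eq_L1norm (fun x => fejer_sum_pow2D A m x (ltnW mA))).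
have := ler_L1normD (tameD (tF (2 ^ A)%N) tD) trF.
have := ler_L1normD (tF (2 ^ A)%N) tD.
rewrite L1normZ ?L1norm_dirichlet_pow2 ?mulr1 ?ger0_norm//; last first.
  exact: tame_dirichlet.
have -> : L1norm (fun x => r A x * fejer_sum m x) = L1norm (fejer_sum m).
  by apply: eq_Rintegral => x _; rewrite normrM /rademacher normrX normrN1 expr1n mul1r.
have := L1norm_fejer_sum_pow2 A; rewrite natrD natrX.
have : m%:R <= 2 ^+ A :> R by rewrite -natrX ler_nat ltnW.
(* The bounds add up to [2 ^ A + m + 2 m], which is at most [2 (2 ^ A + m)] because [m <= 2 ^ A]. *)
move: IHm => h1 h2 h3 h4 h5; lra.
Qed.

End fejer_kernel.

(** * The conjugate Fejer kernel of a dyadic rational *)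

Section conjugate_fejer.
Context {R : realType}.
Notation P := (walsh_measure R).
Notation walsh := (@walsh R).
Implicit Types (t : R) (x : walsh_group).

(** The term [a j] occurs in the partial sums with [j < k < n], and there are [n - j - 1] of
    them. *)
Lemma sum_partial_sums {V : zmodType} (a : nat -> V) n :
  \sum_(k < n) \sum_(j < k) a j = \sum_(j < n) a j *+ (n - j.+1).
Proof.
elim: n => [|n IH]; first by rewrite !big_ord0.
rewrite !big_ord_recr/= IH subnn mulr0n addr0 -big_split/=.
by apply: eq_bigr => j _; rewrite subSS -[in RHS](subnSK (ltn_ord j)) mulrSr.
Qed.

(** For [t = p / 2 ^ e] the digits vanish from position [e] on, and for [k >= 2 ^ e] the multiplier
    reads a digit beyond that position. *)
Lemma conj_mult_dyadic t : dyadic_rational t ->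
  exists K, forall k, (K <= k)%N -> conj_mult t k = 1.
Proof.
move=> [p [e [_ ->]]]; exists (2 ^ e)%N => k ek.
rewrite /conj_mult gtn_eqF; last by rewrite (leq_trans _ ek)// expn_gt0.
rewrite digit_dyadic ?expr0// (leq_trans _ (leqnSn _))//.
by rewrite trunc_log_max.
Qed.

Lemma conj_mult_norm t k : `|conj_mult t k| = 1.
Proof. by rewrite /conj_mult; case: ifP; rewrite normrX normrN1 expr1n. Qed.

(** This is the multiplier form to which [walsh_multiplier_L1] applies. *)
Lemma conj_fejerE t n f x : conj_fejer t n f x =
  \sum_(k < n) (n%:R^-1 * (conj_mult t k *+ (n - k.+1))) * walsh_coef f k * walsh k x.
Proof.
rewrite /conj_fejer /conj_sum.
rewrite (sum_partial_sums (fun k => conj_mult t k * walsh_coef f k * walsh k x)).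
rewrite mulr_sumr; apply: eq_bigr => k _.
by rewrite -!mulrnAl -!mulrA.
Qed.

Lemma L1norm_le_sum_coef (m : nat -> R) n :
  L1norm (fun x => \sum_(k < n) m k * walsh k x) <= \sum_(k < n) `|m k|.
Proof.
rewrite -[leRHS]ger0_norm ?sumr_ge0// -L1norm_cst; apply: le_Rintegral => //.
- exact: (tame_integrable (tame_norm (tame_walsh_sum m n))).
- exact: (tame_integrable (tame_norm (tame_cst _))).
- move=> x _; rewrite [leRHS]ger0_norm ?sumr_ge0// (le_trans (ler_norm_sum _ _ _))//.
  by apply: ler_sum => k _; rewrite normrM walsh_norm mulr1.
Qed.

(** Writing [conj_mult t k] as [1 + (conj_mult t k - 1)] splits off the Fejer kernel, of norm at
    most 2. The rest has at most [K] nonzero coefficients, each of absolute value at most 2. *)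
Lemma L1norm_conj_fejer_kernel t K n :
  (forall k, (K <= k)%N -> conj_mult t k = 1) -> (0 < n)%N ->
  L1norm (fun x => \sum_(k < n)
    n%:R^-1 * (conj_mult t k *+ (n - k.+1)) * walsh k x) <= 2 + 2 * K%:R.
Proof.
move=> tK n0.
pose m k := n%:R^-1 * ((conj_mult t k - 1) *+ (n - k.+1)).
rewrite (@eq_L1norm _ _ (fun x =>
  n%:R^-1 * fejer_sum n x + \sum_(k < n) m k * walsh k x)); last first.
  move=> x; rewrite /fejer_sum /dirichlet (sum_partial_sums (fun k => walsh k x)).
  rewrite mulr_sumr -big_split/=; apply: eq_bigr => k _; rewrite /m.
  rewrite mulrnBl mulrBr mulrBl addrCA -[_ * _%:R * _]mulrA mulr_natl.
  by rewrite subrr addr0.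
have tF := tame_fejer_sum (R := R) n.
rewrite (le_trans (ler_L1normD (tameM (tame_cst _) tF) (tame_walsh_sum m n)))//.
apply: lerD.
  rewrite L1normZ// ger0_norm ?invr_ge0// mulrC ler_pdivrMr ?ltr0n//.
  exact: L1norm_fejer_sum.
rewrite (le_trans (L1norm_le_sum_coef m n))//.
have mK k : (K <= k)%N -> `|m k| = 0.
  by move=> Kk; rewrite /m tK// subrr mul0rn mulr0 normr0.
(* Here [|conj_mult t k - 1| <= 2], and the weight [(n - k.+1) / n] is at most 1. *)
have m2 k : `|m k| <= 2.
  rewrite /m normrM normrMn ger0_norm ?invr_ge0// mulrC ler_pdivrMr ?ltr0n//.
  rewrite -[leLHS]mulr_natr ler_pM// ?ler_nat ?leq_subr//.
  by rewrite (le_trans (ler_normB _ _))// conj_mult_norm normr1.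
rewrite -(big_mkord xpredT (fun k => `|m k|)).
(* If [n <= K], nonnegative terms are added; otherwise the terms dropped from [K] on are zero. *)
rewrite (le_trans (y := \sum_(0 <= k < K) `|m k|))//.
  have [nK|/ltnW Kn] := leqP n K.
    by rewrite (big_cat_nat (n := n) (p := K))//= lerDl sumr_ge0.
  rewrite (big_cat_nat (n := K))//= gerDl big_nat big1// => k /andP[Kk _].
  exact: mK.
rewrite big_mkord; apply: (@le_trans _ _ (\sum_(k < K) 2)).
  by apply: ler_sum => k _; exact: m2.
by rewrite sumr_const card_ord mulr_natr.
Qed.

End conjugate_fejer.

(** * The uniform L1 bound for the conjugate Fejer means *)

Theorem theorem2 (R : realType) (t : R) (t01 : 0 <= t < 1)
    (dt : dyadic_rational t) :
  exists c : R, 0 < c /\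
    forall f : walsh_group -> R,
      (walsh_measure R).-integrable setT (EFin \o f) ->
      forall n : nat, (1 <= n)%N ->
        ('E_(walsh_measure R)[(fun x => `|conj_fejer t n f x|)%R] <=
           c%:E * 'E_(walsh_measure R)[(fun x => `|f x|)%R])%E.
Proof.
have [K tK] := conj_mult_dyadic _ dt.
(* [K] comes from [t] alone, so the constant is independent of [f] and [n]. *)
exists (2 + 2 * K%:R); split; first by rewrite ltr_wpDr.
move=> f fi n n1.
pose m k := n%:R^-1 * (conj_mult t k *+ (n - k.+1)).
(* Integrability makes the expectations finite, which reduces the claim to an inequality between
   real integrals. *)
have EE (g : walsh_group -> R) :
    (walsh_measure R).-integrable setT (EFin \o g) ->
    'E_(walsh_measure R)[(fun x => `|g x|)%R]%E = (L1norm g)%:E.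
  move=> gi; rewrite unlock /L1norm /Rintegral fineK//.
  exact: (integrable_fin_num measurableT (integrable_norm gi)).
have tg := tame_walsh_sum (fun k => m k * walsh_coef f k) n.
have -> : (fun x => `|conj_fejer t n f x|) =
    (fun x => `|\sum_(k < n) m k * walsh_coef f k * walsh k x|).
  by apply/funext => x; rewrite conj_fejerE.
rewrite (EE _ (tame_integrable tg)) EE// -EFinM lee_fin.
rewrite (le_trans (walsh_multiplier_L1 m n f fi))//.
rewrite ler_wpM2r ?Rintegral_ge0//.
exact: L1norm_conj_fejer_kernel.
Qed.
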